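(* Let $H$ be a finite simple connected graph with $|V(H)|\ge 2$ and $H\neq K_2$. Let $\{G_n\}_{n\ge 1}$ be a sequence of finite simple graphs with $|V(G_n)|\to\infty$, and let $\{c_n\}_{n\ge1}$ be positive integers with $c_n\to\infty$; for each $n$ the vertices of $G_n$ are colored uniformly at random with $c_n$ colors. Suppose that for some real number $\lambda$ $$\lim_{n\to\infty}\mathbb{E}\,T(H,G_n)=\lambda\quad\text{and}\quad \lim_{n\to\infty}\mathrm{Var}\,T(H,G_n)=\lambda .$$ Then $T(H,G_n)$ converges in distribution to $\mathrm{Pois}(\lambda)$ as $n\to\infty$.
   Context: In a uniformly random $c_n$-coloring of $G_n$, the vertices $v\in V(G_n)$ receive independent colors $X_v$, each uniform on $\{1,\dots,c_n\}$. Let $V(H)=\{1,\dots,|V(H)|\}$ and let $(a_{ij}(G_n))$ be the adjacency matrix of $G_n$. Define $$T(H,G_n)=\frac{1}{|Aut(H)|}\sum_{\boldsymbol s}\ \prod_{(a,b)\in E(H)}a_{s_as_b}(G_n)\,\mathbf 1\{X_{s_1}=\cdots=X_{s_{|V(H)|}}\},$$ the sum being over all tuples $\boldsymbol s=(s_1,\dots,s_{|V(H)|})$ of distinct vertices of $G_n$, and $Aut(H)$ being the automorphism group of $H$. Thus $T(H,G_n)$ is the number of monochromatic copies of $H$ (subgraphs of $G_n$ isomorphic to $H$, not necessarily induced). $\mathrm{Pois}(0)$ is the point mass at $0$. *)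

(* Defs.v *)
From HB Require Import structures.
From mathcomp Require Import all_boot all_order all_algebra perm.
From mathcomp Require Import all_classical all_reals all_analysis.
From mathcomp Require Import measurable_realfun.

Set Implicit Arguments.
Unset Strict Implicit.
Unset Printing Implicit Defensive.

Import Order.TTheory GRing.Theory Num.Theory.
Import numFieldNormedType.Exports.

Local Open Scope classical_set_scope.
Local Open Scope ring_scope.

Record sgraph := SGraph {
  vertex :> finType;
  adj : rel vertex;
  adj_sym : symmetric adj;
  adj_irrefl : irreflexive adj }.

Definition connected_graph (H : sgraph) : Prop :=
  forall u v : H, connect (@adj H) u v.

Definition isomorphic (H K : sgraph) : Prop :=
  exists2 f : H -> K, bijective f & forall u v, adj (f u) (f v) = adj u v.

Lemma neq_ord_sym n : symmetric (fun i j : 'I_n => i != j).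
Proof. by move=> i j; rewrite eq_sym. Qed.

Lemma neq_ord_irrefl n : irreflexive (fun i j : 'I_n => i != j).
Proof. by move=> i; rewrite eqxx. Qed.

Definition complete_graph (n : nat) : sgraph :=
  SGraph (@neq_ord_sym n) (@neq_ord_irrefl n).

(* [enum_rank] is the labelling of V(H) by 0, ..., |V(H)| - 1: each edge is the
   pair (a, b) of its endpoints with the label of a smaller than that of b. *)
Definition edges (H : sgraph) : {set H * H} :=
  [set e : H * H | adj e.1 e.2 & (enum_rank e.1 < enum_rank e.2)%N].

Definition graph_aut (H : sgraph) : {set {perm H}} :=
  [set f : {perm H} | [forall u, forall v, adj (f u) (f v) == adj u v]].

Section monochromatic_copies.
Variables (R : realType) (H G : sgraph).

Definition adjacency (u v : G) : R := (adj u v)%:R.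

Definition monochromatic (x : G -> nat) (s : {ffun H -> G}) : bool :=
  [forall a, forall b, x (s a) == x (s b)].

(* A tuple of distinct vertices of G, indexed by V(H), is an injective [s]. *)
Definition mono_copies (x : G -> nat) : R :=
  #|graph_aut H|%:R^-1 *
  \sum_(s : {ffun H -> G} | injectiveb s)
    ((\prod_(e in edges H) adjacency (s e.1) (s e.2)) *
     (monochromatic x s)%:R).

Context d (Omega : measurableType d) (P : probability Omega R).
Variable X : G -> {RV P >-> nat}.

Definition T_fun (w : Omega) : R := mono_copies (fun v => X v w).

Lemma measurable_monochromatic (s : {ffun H -> G}) :
  measurable_fun [set: Omega] (fun w => monochromatic (fun v => X v w) s).
Proof.
apply: (measurable_fun_bool true) => //.
rewrite setTI.
rewrite (_ : _ @^-1` _ =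
  \bigcap_(a in [set: H]) \bigcap_(b in [set: H])
    \bigcup_(k : nat) ((X (s a) @^-1` [set k]) `&` (X (s b) @^-1` [set k]))).
  apply: fin_bigcap_measurable => // a _.
  apply: fin_bigcap_measurable => // b _.
  apply: bigcup_measurable => k _.
  by apply: measurableI; rewrite -[_ @^-1` _]setTI; exact: measurable_funP.
apply/seteqP; split => w /=.
  move=> /forallP h a _ b _; exists (X (s a) w) => //.
  by have /forallP/(_ b)/eqP Eab := h a; split => //=; rewrite Eab.
move=> h; apply/forallP => a; apply/forallP => b.
by have [k _ [/= Ea Eb]] := h a I b I; rewrite Ea Eb.
Qed.

Lemma measurable_T_fun : measurable_fun [set: Omega] T_fun.
Proof.
apply: measurable_funM => //.
rewrite [X in measurable_fun _ X](_ : _ = fun w =>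
  \sum_(s <- [seq s : {ffun H -> G} <- enum {: {ffun H -> G}} |
                injectiveb s])
    ((\prod_(e in edges H) adjacency (s e.1) (s e.2)) *
     (monochromatic (X ^~ w) s)%:R)); last first.
  by apply/funext => w; rewrite big_filter big_enum_cond.
apply: measurable_sum => s.
apply: measurable_funM => //.
rewrite (_ : (fun _ => _) =
  (fun b : bool => b%:R : R) \o (fun w => monochromatic (X ^~ w) s)) //.
by apply: measurableT_comp => //; exact: measurable_monochromatic.
Qed.

HB.instance Definition _ :=
  isMeasurableFun.Build _ _ _ _ T_fun measurable_T_fun.

Definition T : {RV P >-> R} := T_fun.

End monochromatic_copies.

Section random_coloring.
Context (R : realType) d (Omega : measurableType d) (P : probability Omega R).

Definition mutually_independent (I : finType) d' (S : measurableType d')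
    (Y : I -> {RV P >-> S}) : Prop :=
  forall (J : {set I}) (B : I -> set S), (forall i, measurable (B i)) ->
    (P (\bigcap_(i in [set` J]) (Y i @^-1` B i)) =
     \prod_(i in J) P (Y i @^-1` B i))%E.

(* These c masses already sum to 1, so every other value has probability 0. *)
Definition uniform_color (c : nat) (Y : {RV P >-> nat}) : Prop :=
  forall k : nat, (1 <= k <= c)%N -> P (Y @^-1` [set k]) = (c%:R^-1)%:E.

Definition uniform_coloring (G : sgraph) (c : nat) (X : G -> {RV P >-> nat}) :
  Prop := mutually_independent X /\ forall v, uniform_color c (X v).

End random_coloring.

Section convergence_in_distribution.
Variable R : realType.

(* Convergence of the distribution functions at every continuity point of the
   limiting one. *)
Definition cvg_in_distribution (d : nat -> measure_display)
    (Omega : forall n, measurableType (d n))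
    (P : forall n, probability (Omega n) R)
    (Z : forall n, {RV (P n) >-> R}) (mu : probability R R) : Prop :=
  forall r : R, {for r, continuous (fun t : R => mu `]-oo, t]%classic)} ->
    cdf (Z n) r @[n --> \oo] --> mu `]-oo, r]%classic.

Definition natr (k : nat) : R := k%:R.

Lemma measurable_natr : measurable_fun [set: nat] natr.
Proof. by []. Qed.

HB.instance Definition _ :=
  isMeasurableFun.Build _ _ _ _ natr measurable_natr.

(* The Poisson law carried to R; [poisson_prob] ignores its second argument
   and is the point mass at 0 when the rate is 0. *)
Definition Pois (rate : R) : probability R R :=
  distribution (poisson_prob rate 0) natr.

End convergence_in_distribution.

(* Main.v *)
Require Import Defs.
From mathcomp Require Import all_boot all_order all_algebra perm.
From mathcomp Require Import all_classical all_reals all_analysis.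
From mathcomp Require Import measurable_realfun.
From mathcomp Require Import lra ring.

(** The number of monochromatic copies of H is N = sum_i I_i, where i ranges
    over the copies of H in the graph, S i is the vertex set of the copy i, and
    I_i says that S i is monochromatic. With r = |V(H)| >= 2, each I_i has
    probability p = c ^ -(r - 1). The proof is a Stein-Chen argument by coupling.

    Two copies that share at most one vertex are independent, and two copies
    that share two vertices or more (a close pair) are positively correlated,
    with P(I_i = I_j = 1) >= c p ^ 2. Hence the difference between the variance
    and the mean controls the sum Q of P(I_i = I_j = 1) over the close pairs
    (overlap_le_variance), and the hypotheses give Q -> 0.

    Fix a vertex u_i in each S i. Repainting all of S i with the color of u_i
    turns the uniform coloring into the coloring conditioned on I_i = 1
    (mean_recolor). So for any f, the mean of N f(N) is the sum over i of p times
    the mean of f(N^i), where N^i is the count after the repainting. If N^i is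
    close to N + 1 on average, this mean is about E(N) times the mean of f(N + 1);
    with f the indicator of k + 1, one gets the Poisson recursion
    (k + 1) P(N = k + 1) = E(N) P(N = k), up to an error.

    The error counts the copies j affected by the repainting of S i. Close pairs
    contribute at most 2 Q. A copy j that meets S i in a single vertex w is
    affected only if w <> u_i, and this is where the choice of u_i matters: with
    u_i any vertex, a vertex lying in almost all copies would ruin the bound. So
    u_i is chosen in as many copies as possible. If w is another vertex
    of S i, then w lies in at most as many copies as u_i, and a Cauchy-Schwarz
    estimate bounds the number of such pairs (i, j) in terms of the numbers of
    copies containing two given vertices, that is of the close pairs again
    (sum_nonhub_degree). Altogether the error is
    O(Q + c ^ (-1/2) (E(N) + Q + E(N) ^ 2)) (stein_recursion).

    The recursion holds in the limit, with E(N) replaced by lambda; as the means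
    are bounded no mass escapes to infinity, and P(N = k) tends to the
    Poisson weight for each k (poisson_limit). Finite sums of these weights are
    the values of the distribution functions. *)

Set Implicit Arguments.
Unset Strict Implicit.
Unset Printing Implicit Defensive.

Import Order.TTheory GRing.Theory Num.Theory.
Import numFieldNormedType.Exports.

Local Open Scope ring_scope.

(** * Averages over uniform colorings *)

Section uniform_mean.
Variables (R : realType) (V : finType) (c : nat).
Hypothesis c_gt0 : (0 < c)%N.
Local Notation coloring := {ffun V -> 'I_c}.
Implicit Types (x y : coloring) (S : {set V}) (g : coloring -> R).

Definition mean g : R := (\sum_x g x) / #|{: coloring}|%:R.

Definition constant_on x S : bool :=
  [forall a in S, forall b in S, x a == x b].

(** Repainting S with the color of one of its vertices u turns a uniform
    coloring into a uniform coloring conditioned on S being monochromatic. *)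
Definition recolor S u x : coloring :=
  [ffun v => if v \in S then x u else x v].

Lemma constant_onP x S :
  reflect {in S &, forall a b, x a = x b} (constant_on x S).
Proof.
apply: (iffP idP) => [/forall_inP h a b aS bS|h].
  by have /forall_inP/(_ b bS)/eqP := h a aS.
by apply/forall_inP => a aS; apply/forall_inP => b bS; apply/eqP/h.
Qed.

Lemma card_coloring_gt0 : 0 < #|{: coloring}|%:R :> R.
Proof. by rewrite ltr0n card_ffun card_ord expn_gt0 c_gt0. Qed.

Lemma mean_cst a : mean (fun=> a) = a.
Proof.
rewrite /mean sumr_const -[a *+ _]mulr_natr mulfK// gt_eqF//.
exact: card_coloring_gt0.
Qed.

Lemma mean_sum (I : finType) (A : pred I) (g : I -> coloring -> R) :
  mean (fun x => \sum_(i | A i) g i x) = \sum_(i | A i) mean (g i).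
Proof. by rewrite /mean exchange_big mulr_suml. Qed.

Lemma meanD g1 g2 : mean (fun x => g1 x + g2 x) = mean g1 + mean g2.
Proof. by rewrite /mean big_split mulrDl. Qed.

Lemma meanZ a g : mean (fun x => a * g x) = a * mean g.
Proof. by rewrite /mean -mulr_sumr mulrA. Qed.

Lemma meanB g1 g2 : mean (fun x => g1 x - g2 x) = mean g1 - mean g2.
Proof. by rewrite /mean sumrB mulrBl. Qed.

Lemma le_mean g1 g2 : (forall x, g1 x <= g2 x) -> mean g1 <= mean g2.
Proof.
move=> h; rewrite ler_pM2r ?invr_gt0 ?card_coloring_gt0//.
by apply: ler_sum => x _; exact: h.
Qed.

Lemma ler_norm_mean g : `|mean g| <= mean (fun x => `|g x|).
Proof.
rewrite normrM [X in _ * X]ger0_norm ?invr_ge0 ?(ltW card_coloring_gt0)//.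
by rewrite ler_pM2r ?invr_gt0 ?card_coloring_gt0// ler_norm_sum.
Qed.

Lemma recolor_constant S u x : u \in S -> constant_on (recolor S u x) S.
Proof. by move=> uS; apply/constant_onP => a b aS bS; rewrite !ffunE aS bS. Qed.

(** A monochromatic y only forgets the colors on S minus u, which are free. *)
Lemma card_recolor_fiber S u y : u \in S -> constant_on y S ->
  #|[set x | recolor S u x == y]| = (c ^ (#|S|.-1))%N.
Proof.
move=> uS /constant_onP yS.
pose F v : pred 'I_c := if v \in S :\ u then predT else pred1 (y v).
transitivity (\prod_(v : V) #|F v|)%N.
  have := card_family F; rewrite foldrE big_image => <-.
  apply: eq_card => x; rewrite inE; apply/eqP/familyP => [E v|xF].
    rewrite /F -E !inE ffunE; case: (eqVneq v u) => [->|_] /=; first by rewrite uS inE.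
    by case: ifP => //= vS; rewrite vS inE.
  apply/ffunP => v; rewrite ffunE.
  have := xF u; rewrite /F in_setD1 eqxx /= inE => /eqP xu.
  case: ifP => vS; first by rewrite xu; apply: yS.
  by have := xF v; rewrite /F in_setD1 vS andbF inE => /eqP.
rewrite (bigID (mem (S :\ u)))/= [X in (_ * X)%N]big1 => [|v vS]; last first.
  by rewrite /F (negbTE vS) card1.
rewrite muln1 (eq_bigr (fun=> c)) => [|v vS]; last by rewrite /F vS card_ord.
by rewrite prod_nat_const; congr (c ^ _)%N; rewrite (cardsD1 u S) uS.
Qed.

Lemma sum_recolor S u g : u \in S ->
  \sum_x g (recolor S u x) = c%:R ^+ (#|S|.-1) * \sum_(x | constant_on x S) g x.
Proof.
move=> uS; rewrite (partition_big (recolor S u) (constant_on^~ S)) /=; last first.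
  by move=> x _; exact: recolor_constant.
rewrite mulr_sumr; apply: eq_bigr => y yS.
rewrite (eq_bigr (fun=> g y)) => [|x /eqP->//].
rewrite sumr_const -natrX -(card_recolor_fiber uS yS) mulr_natl.
by congr (_ *+ _); apply: eq_card => x; rewrite !inE.
Qed.

(** The coupling identity: the map recolor has all its nonempty fibers of the
    same size, so it transports the uniform law to the conditional one. *)
Lemma mean_recolor S u g : u \in S ->
  mean (fun x => (constant_on x S)%:R * g x) =
  c%:R ^- (#|S|.-1) * mean (fun x => g (recolor S u x)).
Proof.
move=> uS; rewrite /mean sum_recolor// mulrA mulKf; last first.
  by rewrite expf_neq0// pnatr_eq0 -lt0n.
congr (_ / _); rewrite [RHS]big_mkcond; apply: eq_bigr => x _.
by case: ifP => _; rewrite ?mul1r ?mul0r.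
Qed.

Lemma mean_constant_on S u : u \in S ->
  mean (fun x => (constant_on x S)%:R) = c%:R ^- (#|S|.-1).
Proof.
move=> uS; have := mean_recolor (fun=> 1) uS.
rewrite mean_cst mulr1 => <-; congr mean; apply/funext => x.
by rewrite mulr1.
Qed.

Lemma constant_on_recolor S S' u x : u \in S -> S :&: S' \subset [set u] ->
  constant_on (recolor S u x) S' = constant_on x S'.
Proof.
move=> uS /fintype.subsetP SS'.
have E v : v \in S' -> recolor S u x v = x v.
  move=> vS'; rewrite ffunE; case: ifP => // vS.
  by have := SS' v; rewrite !inE vS vS' => /(_ isT)/eqP ->.
by apply/constant_onP/constant_onP => h a b aS bS; move: (h a b aS bS); rewrite !E.
Qed.

Lemma constant_on_recolor_meet S S' u x : u \in S -> u \in S' ->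
  constant_on (recolor S u x) S' = constant_on x (u |: (S' :\: S)).
Proof.
move=> uS uS'; apply/constant_onP/constant_onP => h a b.
  have E v : v \in u |: (S' :\: S) -> (v \in S') /\ recolor S u x v = x v.
    rewrite !inE ffunE => /orP[/eqP->|/andP[/negbTE-> ->]]//.
    by rewrite uS uS'.
  by move=> /E[aS' <-] /E[bS' <-]; exact: h.
have E v : v \in S' -> exists2 w, w \in u |: (S' :\: S) & recolor S u x v = x w.
  move=> vS'; rewrite ffunE; case: ifP => vS.
    by exists u => //; rewrite !inE eqxx.
  by exists v => //; rewrite !inE vS vS' orbT.
by move=> /E[a' aS' ->] /E[b' bS' ->]; exact: h.
Qed.

(** Two sets sharing at most one vertex u are independent: repainting the first
    one with the color of u does not touch the second one. *)
Lemma mean_constant_on2_le1 S S' : S != finset.set0 -> S' != finset.set0 ->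
  (#|S :&: S'| <= 1)%N ->
  mean (fun x => (constant_on x S)%:R * (constant_on x S')%:R) =
  c%:R ^- (#|S|.-1) * c%:R ^- (#|S'|.-1).
Proof.
move=> /set0Pn[v vS] /set0Pn[v' v'S'] SS'.
have [u uS SS'u] : exists2 u, u \in S & S :&: S' \subset [set u].
  have [E|[u]] := set_0Vmem (S :&: S').
    by exists v => //; rewrite E finset.sub0set.
  rewrite inE => /andP[uS uS']; exists u => //.
  move: SS'; rewrite (cardsD1 u) inE uS uS' add1n ltnS leqn0 cards_eq0 => /eqP E.
  apply/fintype.subsetP => w wSS'; rewrite inE; apply/negPn/negP => wu.
  by have : w \in (S :&: S') :\ u; [rewrite in_setD1 wu | rewrite E inE].
rewrite (mean_recolor _ uS); congr (_ * _).
rewrite -(mean_constant_on v'S'); congr mean; apply/funext => x.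
by rewrite constant_on_recolor.
Qed.

(** Once S is monochromatic, S' only has to agree on the union of {u} and
    S' minus S, which saves at least one constraint when S and S' share two
    vertices; this gains a factor c over independence. *)
Lemma mean_constant_on2_ge2 S S' : (2 <= #|S :&: S'|)%N ->
  c%:R * (c%:R ^- (#|S|.-1) * c%:R ^- (#|S'|.-1)) <=
  mean (fun x => (constant_on x S)%:R * (constant_on x S')%:R).
Proof.
move=> SS'.
have [u] : exists u, u \in S :&: S' by apply/card_gt0P; rewrite (leq_trans _ SS').
rewrite inE => /andP[uS uS'].
rewrite (mean_recolor _ uS) mulrCA ler_wpM2l ?invr_ge0 ?exprn_ge0//.
have uD : u \in u |: (S' :\: S) by rewrite !inE eqxx.
rewrite (_ : (fun x => _) = fun x => (constant_on x (u |: (S' :\: S)))%:R); last first.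
  by apply/funext => x; rewrite constant_on_recolor_meet.
have c0 : 0 < c%:R :> R by rewrite ltr0n.
have S'2 : (2 <= #|S'|)%N by rewrite (leq_trans SS')// subset_leq_card// subsetIr.
rewrite (mean_constant_on uD) cardsU1 !inE uS /=.
rewrite -(prednK (_ : 0 < #|S'|.-1)%N); last by rewrite -subn1 subn_gt0.
rewrite exprS invfM mulVKf ?gt_eqF//.
rewrite lef_pV2 ?posrE ?exprn_gt0//.
rewrite ler_weXn2l ?ler1n//.
move: SS'; rewrite -(cardsID S S') (finset.setIC S').
by case: #|_ :&: _| => [|[|k]]// _; rewrite addSn addSn /= leq_addl.
Qed.

End uniform_mean.

(** * Degrees in a uniform hypergraph *)

Section hypergraph.
Variables (R : realType) (V I : finType) (S : I -> {set V}) (r : nat).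
Hypothesis r_ge2 : (2 <= r)%N.
Hypothesis card_S : forall i, #|S i| = r.

Definition degree w : nat := #|[set i | w \in S i]|.

(** Hubs are the vertices whose color is kept by the coupling, so that a
    set meeting S i in its hub only is not affected. *)
Lemma exists_hub i : exists2 u, u \in S i & {in S i, forall w, degree w <= degree u}%N.
Proof.
have [v vS] : exists v, v \in S i by apply/card_gt0P; rewrite card_S ltnW.
have [u uS umax] := @arg_maxnP _ v (mem (S i)) degree vS.
by exists u.
Qed.

Lemma sum_degree : (\sum_w degree w = #|I| * r)%N.
Proof.
rewrite (eq_bigr (fun w => \sum_(i | w \in S i) 1)%N) => [|w _]; last first.
  by rewrite sum1dep_card.
rewrite (exchange_big_dep predT)//= (eq_bigr (fun=> r)) => [|i _]; last first.
  by rewrite sum1_card card_S.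
by rewrite sum_nat_const.
Qed.

(** The dependencies that produce positive covariance; sets that share a single
    vertex are pairwise independent. *)
Definition close_pairs : {set I * I} :=
  [set ij | (ij.1 != ij.2) && (1 < #|S ij.1 :&: S ij.2|)%N].

(** Expanding the squared codegree of (v, w) as a number of pairs (i, j) with v
    and w in both S i and S j: only i = j and the close pairs contribute, each
    of them for at most r ^ 2 choices of (v, w). *)
Lemma sum_codegree_sqr :
  (\sum_v \sum_(w | w != v) #|[set i | (v \in S i) && (w \in S i)]| ^ 2
   <= r ^ 2 * (#|I| + #|close_pairs|))%N.
Proof.
have -> : (\sum_v \sum_(w | w != v) #|[set i | (v \in S i) && (w \in S i)]| ^ 2 =
  \sum_(i : I) \sum_(j : I)
    \sum_v \sum_w [&& w != v, v \in S i :&: S j & w \in S i :&: S j])%N.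
  rewrite [RHS](eq_bigr (fun i => \sum_v \sum_(j : I)
     \sum_w [&& w != v, v \in S i :&: S j & w \in S i :&: S j])%N); last first.
    by move=> i _; rewrite exchange_big.
  rewrite [RHS]exchange_big; apply: eq_bigr => v _.
  rewrite [RHS](eq_bigr (fun i => \sum_w \sum_(j : I)
     [&& w != v, v \in S i :&: S j & w \in S i :&: S j])%N); last first.
    by move=> i _; rewrite exchange_big.
  rewrite [RHS]exchange_big /= big_mkcond; apply: eq_bigr => w _.
  case: eqVneq => [_|wv] /=.
    by rewrite big1// => i _; rewrite big1.
  rewrite -[X in (X ^ 2)%N]sum1dep_card big_mkcond/= expnS expn1 big_distrl/=.
  apply: eq_bigr => i _; rewrite big_distrr/=; apply: eq_bigr => j _.
  rewrite !inE.
  by case: (v \in S i); case: (w \in S i); case: (v \in S j); case: (w \in S j).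
have bound i j : (\sum_v \sum_w [&& w != v, v \in S i :&: S j & w \in S i :&: S j]
   <= r ^ 2 * (1 < #|S i :&: S j|))%N.
  have [Sij|Sij] := ltnP 1 #|S i :&: S j|; last first.
    rewrite muln0 big1// => v _; rewrite big1// => w _; apply/eqP.
    rewrite eqb0; apply/negP => /and3P[wv vS wS].
    by have /(_ _ _ vS wS) E := card_le1_eqP Sij; rewrite E eqxx in wv.
  rewrite muln1; apply: (@leq_trans (#|S i :&: S j| ^ 2)); last first.
    by rewrite leq_exp2r// -(card_S i) subset_leq_card// finset.subsetIl.
  rewrite -sum1_card expnS expn1 big_distrl [leqRHS]big_mkcond/=.
  apply: leq_sum => v _; case: ifP => vS /=; last first.
    by rewrite big1// => w _; rewrite andbF.
  rewrite mul1n [leqRHS]big_mkcond; apply: leq_sum => w _ /=.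
  by case: (w \in _); rewrite ?andbF// leq_b1.
apply: (@leq_trans (\sum_(i : I) \sum_(j : I) r ^ 2 * (1 < #|S i :&: S j|))%N).
  by apply: leq_sum => i _; apply: leq_sum => j _; exact: bound.
have -> : (\sum_i \sum_j r ^ 2 * (1 < #|S i :&: S j|) =
   r ^ 2 * \sum_i \sum_j (1 < #|S i :&: S j|))%N.
  by rewrite big_distrr; apply: eq_bigr => i _; rewrite big_distrr.
rewrite leq_mul2l; apply/orP; right.
have -> : (#|close_pairs| = \sum_i \sum_j ((i, j) \in close_pairs))%N.
  rewrite pair_bigA /= -sum1_card big_mkcond; apply: eq_bigr => -[i j] _ /=.
  by case: ifP.
rewrite -sum1_card.
rewrite -big_split/=; apply: leq_sum => i _.
rewrite (bigD1 i)//= leq_add ?leq_b1// [leqLHS]big_mkcond; apply: leq_sum => j _.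
rewrite inE /= eq_sym; by case: eqVneq.
Qed.

(** The left-hand side counts the pairs of sets meeting at a vertex that is not
    the hub of the first one. Group the sets i by hub v and other vertex w:
    there are at most codegree(v, w) of them, and since w has a degree at most
    that of v, the degree of w is at most the geometric mean of the two. The
    Cauchy-Schwarz inequality then bounds the sum by the squared codegrees, which
    are controlled by the close pairs, and by the square of the sum of the
    degrees; b is the parameter of its arithmetic-geometric mean form. *)
Lemma sum_nonhub_degree (hub : I -> V) (b : R) : 0 < b ->
  (forall i, hub i \in S i) ->
  (forall i, {in S i, forall w, degree w <= degree (hub i)}%N) ->
  \sum_i \sum_(w in S i :\ hub i) (degree w)%:R <=
  b^-1 * (r%:R ^+ 2 * (#|I|%:R + #|close_pairs|%:R)) + b * (#|I|%:R * r%:R) ^+ 2.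
Proof.
move=> b0 hubS hub_max.
pose e v w := #|[set i | (hub i == v) && (w \in S i)]|.
pose e' v w := #|[set i | (v \in S i) && (w \in S i)]|.
have ee' v w : (e v w <= e' v w)%N.
  apply/subset_leq_card/fintype.subsetP => i; rewrite !inE => /andP[/eqP<- ->].
  by rewrite hubS.
have -> : \sum_i \sum_(w in S i :\ hub i) (degree w)%:R =
    \sum_v \sum_(w | w != v) (e v w)%:R * (degree w)%:R :> R.
  under [RHS]eq_bigr => v _.
    under eq_bigr => w _.
      rewrite /e -sum1dep_card natr_sum mulr_suml big_mkcond /=.
      over.
    rewrite exchange_big /=; over.
  rewrite [RHS]exchange_big /=; apply: eq_bigr => i _.
  rewrite [RHS](bigD1 (hub i)) //= [X in _ = _ + X]big1 ?addr0; last first.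
    by move=> v vi; rewrite big1// => w _; rewrite eq_sym (negbTE vi).
  rewrite eqxx /= [LHS]big_mkcond [RHS]big_mkcond; apply: eq_bigr => w _.
  by rewrite in_setD1; case: eqVneq => //= _; case: ifP; rewrite ?mul1r.
have term v w : (e v w)%:R * (degree w)%:R <=
    b^-1 * (e' v w ^ 2)%:R + b * ((degree v)%:R * (degree w)%:R) :> R.
  have [->|] := eqVneq (e v w) 0%N.
    by rewrite mul0r addr_ge0// mulr_ge0// ?invr_ge0 ltW// ltW.
  rewrite -lt0n => /card_gt0P[i]; rewrite inE => /andP[/eqP iv wS].
  have dw : (degree w)%:R <= (degree v)%:R :> R by rewrite ler_nat -iv hub_max.
  have ew : (e v w)%:R <= (e' v w)%:R :> R by rewrite ler_nat.
  rewrite natrX.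
  set x : R := (e v w)%:R in ew *; set y : R := (degree w)%:R in dw *.
  have x0 : 0 <= x by []. have y0 : 0 <= y by [].
  (* x * y <= x ^ 2 / b + b * y ^ 2, and then y <= degree v. *)
  apply: (@le_trans _ _ (b^-1 * x ^+ 2 + b * (y * y))).
    rewrite -(ler_pM2l b0) mulrDr mulVKf ?gt_eqF//.
    have := sqr_ge0 (x - b * y); have := mulr_ge0 (mulr_ge0 (ltW b0) x0) y0; nra.
  apply: lerD; first by rewrite ler_wpM2l ?invr_ge0 ?(ltW b0)// lerXn2r ?nnegrE.
  by rewrite ler_wpM2l ?(ltW b0)// ler_wpM2r.
apply: (@le_trans _ _ (\sum_v \sum_(w | w != v)
    (b^-1 * (e' v w ^ 2)%:R + b * ((degree v)%:R * (degree w)%:R)))).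
  by apply: ler_sum => v _; apply: ler_sum => w _.
rewrite (eq_bigr (fun v => b^-1 * (\sum_(w | w != v) e' v w ^ 2)%N%:R +
   b * ((degree v)%:R * \sum_(w | w != v) (degree w)%:R))); last first.
  by move=> v _; rewrite big_split/= natr_sum !mulr_sumr.
rewrite big_split/= -!mulr_sumr -natr_sum; apply: lerD.
  rewrite ler_wpM2l ?invr_ge0 ?(ltW b0)//.
  by rewrite -natrX -natrD -natrM ler_nat sum_codegree_sqr.
rewrite ler_wpM2l ?(ltW b0)// -natrM -sum_degree natr_sum expr2 mulr_suml.
apply: ler_sum => v _; rewrite ler_wpM2l//.
by rewrite [leLHS]big_mkcond; apply: ler_sum => w _; case: ifP.
Qed.

End hypergraph.

(** * The Stein-Chen bound for the number of monochromatic sets *)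

Section monochromatic_count.
Variables (R : realType) (V I : finType) (S : I -> {set V}) (r c : nat).
Hypothesis r_ge2 : (2 <= r)%N.
Hypothesis card_S : forall i, #|S i| = r.
Hypothesis c_gt0 : (0 < c)%N.
Local Notation coloring := {ffun V -> 'I_c}.
Implicit Types (x : coloring) (i j : I) (u : V).

Definition mono_count x : nat := (\sum_i constant_on x (S i))%N.

Definition expected_count : R := mean (fun x => (mono_count x)%:R).

Definition count_prob k : R := mean (fun x => (mono_count x == k)%:R).

Definition joint i j : R :=
  mean (fun x => (constant_on x (S i))%:R * (constant_on x (S j))%:R).

Definition overlap : R := \sum_(ij in close_pairs S) joint ij.1 ij.2.

Definition mono_prob : R := c%:R ^- r.-1.
Local Notation p := mono_prob.

Lemma mono_prob_ge0 : 0 <= p. Proof. by rewrite invr_ge0 exprn_ge0. Qed.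

Lemma mono_prob_le_invc : p <= c%:R^-1.
Proof.
have c0 : 0 < c%:R :> R by rewrite ltr0n.
rewrite lef_pV2 ?posrE ?exprn_gt0// -[leLHS]expr1.
by rewrite ler_weXn2l ?ler1n// -subn1 subn_gt0.
Qed.

Lemma mean_indicator i : mean (fun x => (constant_on x (S i))%:R) = p.
Proof.
have [u uS] : exists u, u \in S i by apply/card_gt0P; rewrite card_S ltnW.
by rewrite (mean_constant_on R c_gt0 uS) card_S.
Qed.

Lemma expected_countE : expected_count = #|I|%:R * p.
Proof.
rewrite /expected_count.
under eq_fun do rewrite natr_sum.
rewrite mean_sum (eq_bigr (fun=> p)) => [|i _]; last exact: mean_indicator.
by rewrite sumr_const mulr_natl.
Qed.

Lemma joint_far i j : (#|S i :&: S j| <= 1)%N -> joint i j = p * p.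
Proof.
move=> Sij; rewrite /joint mean_constant_on2_le1// ?card_S//.
  by rewrite -card_gt0 card_S ltnW.
by rewrite -card_gt0 card_S ltnW.
Qed.

Lemma joint_close i j : (1 < #|S i :&: S j|)%N -> c%:R * (p * p) <= joint i j.
Proof.
by move=> Sij; have := mean_constant_on2_ge2 R c_gt0 Sij; rewrite !card_S.
Qed.

Lemma joint_ge i j : p * p <= joint i j.
Proof.
have [Sij|Sij] := leqP #|S i :&: S j| 1; first by rewrite joint_far.
apply: le_trans (joint_close Sij).
by rewrite ler_peMl ?mulr_ge0 ?mono_prob_ge0// ler1n.
Qed.

(** No pair has negative covariance. The diagonal contributes the mean up to a
    factor 1 - p, and a close pair contributes its joint probability up to a
    factor 1 - 1 / c, so a variance close to the mean forces the overlap to be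
    small. *)
Lemma overlap_le_variance :
  overlap * (1 - c%:R^-1) <=
  mean (fun x => (mono_count x)%:R ^+ 2) - expected_count ^+ 2
  - expected_count + expected_count / c%:R.
Proof.
have E2 : mean (fun x => (mono_count x)%:R ^+ 2) = \sum_i \sum_j joint i j.
  under eq_fun do rewrite expr2 natr_sum big_distrlr /=.
  by rewrite mean_sum; apply: eq_bigr => i _; rewrite mean_sum.
have L0 : 0 <= expected_count by rewrite expected_countE mulr_ge0 ?mono_prob_ge0.
have joint_diag i : joint i i = p.
  rewrite -(mean_indicator i); congr mean; apply/funext => x.
  by rewrite -natrM mulnb andbb.
have LL : expected_count ^+ 2 = \sum_(i : I) \sum_(j : I) p * p :> R.
  under eq_bigr do rewrite sumr_const.
  by rewrite sumr_const expected_countE -mulrnA -[RHS]mulr_natl natrM; ring.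
have -> : mean (fun x => (mono_count x)%:R ^+ 2) - expected_count ^+ 2 =
    \sum_i \sum_j (joint i j - p * p).
  by rewrite E2 LL -sumrB; apply: eq_bigr => i _; rewrite sumrB.
suff : expected_count - expected_count / c%:R + overlap * (1 - c%:R^-1) <=
  \sum_i \sum_j (joint i j - p * p) by lra.
apply: (@le_trans _ _ (\sum_i ((joint i i - p * p) +
    \sum_j if (i, j) \in close_pairs S then joint i j - p * p else 0))).
  rewrite big_split/=; apply: lerD.
    rewrite (eq_bigr (fun=> p - p * p)) => [|i _]; last by rewrite joint_diag.
    rewrite sumr_const -[leRHS]mulr_natl mulrBr mulrA -expected_countE lerB//.
    by rewrite ler_wpM2l ?mono_prob_le_invc.
  rewrite /overlap mulr_suml pair_bigA /= [leLHS]big_mkcond /=.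
  apply: ler_sum => -[i j] _ /=; case: ifP => //.
  rewrite inE /= => /andP[_ /joint_close h].
  rewrite mulrBr mulr1 lerB// ler_pdivlMr ?ltr0n//.
  by rewrite mulrC.
apply: ler_sum => i _; rewrite [leRHS](bigD1 i)//= lerD2l [leRHS]big_mkcond.
apply: ler_sum => j _; rewrite inE /= eq_sym.
case: eqVneq => //= _; case: ifP => // _.
by rewrite subr_ge0 joint_ge.
Qed.

Lemma mean_deviation i u : u \in S i ->
  mean (fun x => `|(mono_count (recolor (S i) u x))%:R - (mono_count x).+1%:R|)
  <= p + \sum_(j | j != i) mean (fun x =>
     `|(constant_on (recolor (S i) u x) (S j))%:R - (constant_on x (S j))%:R|).
Proof.
move=> uS; rewrite -(mean_indicator i) -mean_sum -meanD.
apply: (le_mean c_gt0) => x; rewrite /mono_count (bigD1 i)//= [in X in _ - X](bigD1 i)//=.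
rewrite (recolor_constant _ uS) -addn1 !natrD !natr_sum /=.
rewrite [X in `|X|](_ : _ = - (constant_on x (S i))%:R + \sum_(j | j != i)
   ((constant_on (recolor (S i) u x) (S j))%:R - (constant_on x (S j))%:R)); last first.
  by rewrite sumrB; ring.
apply: le_trans (ler_normD _ _) _; rewrite normrN ger0_norm// lerD2l.
exact: ler_norm_sum.
Qed.

(** S j is affected by the repainting of S i only if they meet outside u. In
    that case S j is monochromatic after, resp. before, the repainting with a
    probability that is, after multiplication by p, at most the joint one: by
    the coupling identity, resp. by nonnegative correlation. *)
Lemma deviation_term i j u : u \in S i ->
  p * mean (fun x =>
     `|(constant_on (recolor (S i) u x) (S j))%:R - (constant_on x (S j))%:R|)
  <= 2 * (~~ (S i :&: S j \subset [set u]))%:R * joint i j.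
Proof.
move=> uS; have [Sij|Sij] /= := boolP (S i :&: S j \subset [set u]%SET).
  rewrite (_ : (fun x => _) = fun=> 0) ?mean_cst ?mulr0 ?mul0r//.
  by apply/funext => x; rewrite (constant_on_recolor _ uS Sij) subrr normr0.
apply: (@le_trans _ _ (p * (mean (fun x => (constant_on (recolor (S i) u x) (S j))%:R) +
   mean (fun x => (constant_on x (S j))%:R)))).
  rewrite ler_wpM2l ?mono_prob_ge0// -meanD; apply: (le_mean c_gt0) => x.
  by apply: le_trans (ler_normB _ _) _; rewrite !ger0_norm.
rewrite mulrDr mean_indicator.
have := mean_recolor c_gt0 (fun x => (constant_on x (S j))%:R : R) uS.
rewrite card_S -/mono_prob -/(joint i j) => <-.
have := joint_ge i j; lra.
Qed.

Lemma close_pairs_overlap : #|close_pairs S|%:R * (c%:R * (p * p)) <= overlap.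
Proof.
rewrite mulr_natl -sumr_const; apply: ler_sum => -[i j].
by rewrite inE /= => /andP[_]; exact: joint_close.
Qed.

Lemma ler_indicator_dist (a b m : nat) :
  `|(a == m)%:R - (b == m)%:R| <= `|a%:R - b%:R| :> R.
Proof.
have [->|ab] := eqVneq a b; first by rewrite !subrr.
have : (1 : R) <= `|a%:R - b%:R|.
  wlog ba : a b ab / (b < a)%N.
    move=> h; case: (ltngtP b a) => [/h|/h|E]; [exact| |by rewrite E eqxx in ab].
    by rewrite eq_sym distrC; exact.
  by rewrite -natrB ?(ltnW ba)// normr_nat ler1n subn_gt0.
apply: le_trans; case: (a == m); case: (b == m);
  by rewrite ?subrr ?subr0 ?sub0r ?normrN ?normr0 ?normr1.
Qed.

(** For a Poisson variable of mean L the difference on the left is zero. Here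
    its first term is the mean of N f(N), where N is the count and f the indicator
    of k + 1; by the coupling this is the sum over i of p times the mean of f
    at the count after repainting S i, while the second term is the sum of p times
    the mean of f(N + 1). So the difference is at most the total effect of
    the repaintings. That effect comes from S i itself, from the close
    pairs, and from the pairs meeting in one vertex that is not a hub. *)
Lemma stein_recursion k (b : R) : 0 < b ->
  `|k.+1%:R * count_prob k.+1 - expected_count * count_prob k| <=
  expected_count / c%:R + 2 * overlap +
  2 * r%:R ^+ 2 * (b^-1 * ((expected_count + overlap) / c%:R) + b * expected_count ^+ 2).
Proof.
move=> b0.
have /fin_all_exists[hub hubP] : forall i, exists u, u \in S i /\
    {in S i, forall w, degree S w <= degree S u}%N.
  by move=> i; have [u] := exists_hub r_ge2 card_S i; exists u.
have hubS i := (hubP i).1; have hub_max i := (hubP i).2.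
pose f k' : R := (k' == k.+1)%:R.
have -> : k.+1%:R * count_prob k.+1 - expected_count * count_prob k =
  \sum_i p * mean (fun x =>
     f (mono_count (recolor (S i) (hub i) x)) - f (mono_count x).+1).
  under eq_bigr => i _ do rewrite meanB mulrBr.
  rewrite sumrB; congr (_ - _); last first.
    by rewrite sumr_const expected_countE -[RHS]mulr_natl mulrA.
  transitivity (mean (fun x => \sum_i (constant_on x (S i))%:R * f (mono_count x))).
    rewrite -meanZ; congr mean; apply/funext => x.
    rewrite -mulr_suml -natr_sum -/(mono_count x) /f.
    by case: eqP => [->|]; rewrite ?mulr1 ?mulr0.
  rewrite mean_sum; apply: eq_bigr => i _.
  by rewrite (mean_recolor c_gt0 (f \o mono_count) (hubS i)) card_S.
apply: (@le_trans _ _ (\sum_i p * (p + \sum_(j | j != i) mean (fun x =>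
     `|(constant_on (recolor (S i) (hub i) x) (S j))%:R - (constant_on x (S j))%:R|)))).
  apply: le_trans (ler_norm_sum _ _ _) _; apply: ler_sum => i _.
  rewrite normrM (ger0_norm mono_prob_ge0) ler_wpM2l ?mono_prob_ge0//.
  apply: le_trans (ler_norm_mean c_gt0 _) _; apply: le_trans (mean_deviation (hubS i)).
  by apply: (le_mean c_gt0) => x; exact: ler_indicator_dist.
have -> : \sum_i p * (p + \sum_(j | j != i) mean (fun x =>
     `|(constant_on (recolor (S i) (hub i) x) (S j))%:R - (constant_on x (S j))%:R|)) =
  expected_count * p + \sum_i \sum_(j | j != i) p * mean (fun x =>
     `|(constant_on (recolor (S i) (hub i) x) (S j))%:R - (constant_on x (S j))%:R|).
  under eq_bigr => i _ do rewrite mulrDr mulr_sumr.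
  by rewrite big_split/= sumr_const expected_countE -mulrA mulr_natl.
have L0 : 0 <= expected_count by rewrite expected_countE mulr_ge0 ?mono_prob_ge0.
rewrite -[leRHS]addrA; apply: lerD; first by rewrite ler_wpM2l ?mono_prob_le_invc.
apply: (@le_trans _ _ (2 * (overlap +
   p * p * \sum_i \sum_(w in S i :\ hub i) (degree S w)%:R))).
  have -> : overlap =
      \sum_i \sum_j if (i, j) \in close_pairs S then joint i j else 0.
    by rewrite /overlap big_mkcond pair_bigA; apply: eq_bigr => -[].
  rewrite mulr_sumr -big_split mulr_sumr /=; apply: ler_sum => i _.
  have -> : \sum_(w in S i :\ hub i) (degree S w)%:R =
      \sum_j \sum_(w in S i :\ hub i) (w \in S j)%:R :> R.
    rewrite exchange_big; apply: eq_bigr => w _.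
    rewrite /degree -sum1dep_card natr_sum big_mkcond.
    by apply: eq_bigr => j _; case: ifP.
  rewrite mulr_sumr -big_split mulr_sumr /= [leLHS]big_mkcond.
  apply: ler_sum => j _; rewrite inE /= eq_sym.
  have s0 : 0 <= \sum_(w in S i :\ hub i) (w \in S j)%:R :> R.
    by apply: sumr_ge0.
  have [_|ij] /= := eqVneq i j.
    by rewrite add0r !mulr_ge0 ?mono_prob_ge0.
  apply: le_trans (deviation_term j (hubS i)) _.
  rewrite -mulrA ler_pM2l//.
  have [Sij|Sij] := ltnP 1 #|S i :&: S j|.
    rewrite -[leLHS]addr0 lerD// ?mulr_ge0 ?mono_prob_ge0//.
    by rewrite ler_piMl ?lern1 ?leq_b1// (le_trans _ (joint_ge i j))// mulr_ge0 ?mono_prob_ge0.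
  rewrite add0r joint_far// mulrC ler_wpM2l ?mulr_ge0 ?mono_prob_ge0//.
  have [_|] := boolP (_ \subset _); first exact: s0.
  move=> /subsetPn[w]; rewrite !inE => /andP[wi wj] wh.
  by rewrite (bigD1 w) ?in_setD1 ?wh//= wj lerDl sumr_ge0.
rewrite mulrDr lerD2l -[leRHS]mulrA ler_pM2l//.
have pp0 : 0 <= p * p by rewrite mulr_ge0 ?mono_prob_ge0.
apply: le_trans (ler_wpM2l pp0 (sum_nonhub_degree card_S b0 hubS hub_max)) _.
have H1 : #|close_pairs S|%:R * (p * p) <= overlap / c%:R.
  by rewrite ler_pdivlMr ?ltr0n// mulrAC -mulrA close_pairs_overlap.
have H2 : #|I|%:R * (p * p) <= expected_count / c%:R.
  by rewrite mulrA -expected_countE ler_wpM2l ?mono_prob_le_invc.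
rewrite mulrDr.
have -> : p * p * (b^-1 * (r%:R ^+ 2 * (#|I|%:R + #|close_pairs S|%:R))) =
  r%:R ^+ 2 * (b^-1 * (#|I|%:R * (p * p) + #|close_pairs S|%:R * (p * p))).
  by ring.
have -> : p * p * (b * (#|I|%:R * r%:R) ^+ 2) =
  r%:R ^+ 2 * (b * expected_count ^+ 2).
  by rewrite expected_countE; ring.
rewrite -mulrDr ler_wpM2l ?sqr_ge0// lerD2r ler_wpM2l ?invr_ge0 ?(ltW b0)//.
by rewrite mulrDl lerD.
Qed.

Lemma sum_count_prob K :
  \sum_(k < K) count_prob k = mean (fun x => (mono_count x < K)%N%:R).
Proof.
rewrite -mean_sum; congr mean; apply/funext => x.
have [xK|xK] := ltnP (mono_count x) K.
  rewrite (bigD1 (Ordinal xK))//= eqxx big1 ?addr0// => k.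
  by rewrite -val_eqE /= eq_sym => /negbTE ->.
by rewrite big1// => k _; rewrite gtn_eqF// (leq_trans (ltn_ord k)).
Qed.

Lemma count_prob_ge0 k : 0 <= count_prob k.
Proof. by rewrite -[leLHS](mean_cst V c_gt0); apply: le_mean. Qed.

Lemma sum_count_prob_le1 K : \sum_(k < K) count_prob k <= 1.
Proof.
rewrite sum_count_prob -[leRHS](mean_cst V c_gt0).
by apply: le_mean => // x; rewrite lern1 leq_b1.
Qed.

Lemma sum_count_prob_ge K :
  1 - expected_count / K.+1%:R <= \sum_(k < K.+1) count_prob k.
Proof.
rewrite sum_count_prob -[X in X - _](mean_cst V c_gt0 1) [X in _ - X]mulrC.
rewrite -meanZ -meanB; apply: le_mean => // x.
have [xK|xK] := ltnP (mono_count x) K.+1.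
  by rewrite lerBlDr lerDl mulr_ge0// invr_ge0.
by rewrite subr_le0 mulrC ler_pdivlMr// mul1r ler_nat.
Qed.

Lemma overlap_ge0 : 0 <= overlap.
Proof.
apply: sumr_ge0 => ij _; apply: le_trans (joint_ge _ _).
by rewrite mulr_ge0 ?mono_prob_ge0.
Qed.

End monochromatic_count.

(** * Copies of a graph as a hypergraph *)

Section copies.
Variables (H G : sgraph).
Implicit Types (s t : {ffun H -> G}) (f g : {perm H}).

(** The finite colorings take values in {0, ..., c - 1}, the random ones in
    {1, ..., c}: hence the shift. *)
Definition colors c (x : {ffun G -> 'I_c}) : G -> nat := fun v => (x v).+1.

Definition embeds s : bool :=
  injectiveb s && [forall u, forall v, adj u v ==> adj (s u) (s v)].

Definition relabel s f : {ffun H -> G} := [ffun a => s (f a)].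

(** A copy of H is encoded as the set of all its labellings, an orbit of the
    automorphism group of H. *)
Definition copy_of s : {set {ffun H -> G}} := relabel s @: graph_aut H.

Definition copies : {set {set {ffun H -> G}}} := copy_of @: [set s | embeds s].

Lemma graph_autP f :
  reflect (forall u v, adj (f u) (f v) = adj u v) (f \in graph_aut H).
Proof.
rewrite inE; apply: (iffP forallP) => [h u v|h u].
  by have /forallP/(_ v)/eqP := h u.
by apply/forallP => v; apply/eqP.
Qed.

Lemma graph_aut_mul f g :
  f \in graph_aut H -> g \in graph_aut H -> (f * g)%g \in graph_aut H.
Proof.
by move=> /graph_autP hf /graph_autP hg; apply/graph_autP => u v; rewrite !permM hg.
Qed.

Lemma graph_aut_inv f : f \in graph_aut H -> (f^-1)%g \in graph_aut H.
Proof. by move=> /graph_autP hf; apply/graph_autP => u v; rewrite -hf !permKV. Qed.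

Lemma graph_aut_one : (1%g : {perm H}) \in graph_aut H.
Proof. by apply/graph_autP => u v; rewrite !perm1. Qed.

Lemma copy_of_refl s : s \in copy_of s.
Proof.
apply/imsetP; exists 1%g; first exact: graph_aut_one.
by apply/ffunP => a; rewrite ffunE perm1.
Qed.

Lemma copy_of_eq s t : t \in copy_of s -> copy_of t = copy_of s.
Proof.
move=> /imsetP[f fA ->]; apply/setP => u; apply/imsetP/imsetP => -[g gA ->].
  exists (g * f)%g; first exact: graph_aut_mul.
  by apply/ffunP => a; rewrite !ffunE permM.
exists (g * f^-1)%g; first exact/graph_aut_mul/graph_aut_inv.
by apply/ffunP => a; rewrite !ffunE permM permKV.
Qed.

Lemma card_copy_of s : injective s -> #|copy_of s| = #|graph_aut H|.
Proof.
move=> s_inj; apply: card_imset => f g /ffunP fg; apply/permP => a.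
by apply: s_inj; have := fg a; rewrite !ffunE.
Qed.

Lemma embeds_relabel s f : f \in graph_aut H -> embeds s -> embeds (relabel s f).
Proof.
move=> /graph_autP fA /andP[/injectiveP s_inj /forallP sE]; apply/andP; split.
  by apply/injectiveP => a b; rewrite !ffunE => /s_inj/perm_inj.
apply/forallP => u; apply/forallP => v; rewrite !ffunE -fA.
by have /forallP := sE (f u).
Qed.

Lemma relabel_image s f : [set relabel s f a | a : H] = [set s a | a : H].
Proof.
apply/setP => v; apply/imsetP/imsetP => -[a _ ->].
  by exists (f a); rewrite ?ffunE.
by exists (f^-1%g a); rewrite ?ffunE ?permKV.
Qed.

Definition copy_support (O : {set {ffun H -> G}}) : {set G} :=
  \bigcup_(s in O) [set s a | a : H].

Lemma copy_supportE s : copy_support (copy_of s) = [set s a | a : H].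
Proof.
apply/eqP; rewrite finset.eqEsubset; apply/andP; split.
  apply/bigcupsP => t /imsetP[f _ ->]; by rewrite relabel_image.
exact: (bigcup_max _ (copy_of_refl s)).
Qed.

Lemma card_copy_support (O : {O in copies}) : #|copy_support (val O)| = #|H|.
Proof.
case: O => O /= /imsetP[s]; rewrite inE => /andP[/injectiveP s_inj _] ->.
by rewrite copy_supportE card_imset.
Qed.

(** The product runs over one orientation of each edge of H, so symmetry of
    the two adjacency relations is what makes it test all adjacent pairs. *)
Lemma prod_adjacency (R : realType) s :
  \prod_(e in edges H) adjacency R (s e.1) (s e.2) =
  ([forall u, forall v, adj u v ==> adj (s u) (s v)])%:R.
Proof.
case: (boolP [forall u, _]) => [/forallP h|].
  rewrite big1// => -[u v]; rewrite inE /= => /andP[uv _].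
  by have /forallP/(_ v)/implyP/(_ uv) := h u; rewrite /adjacency => ->.
move=> /forallPn[u /forallPn[v]]; rewrite negb_imply => /andP[uv suv].
suff [e eE se] : exists2 e, e \in edges H & ~~ adj (s e.1) (s e.2).
  by rewrite (bigD1 e)//= /adjacency (negbTE se) mul0r.
case: (ltngtP (enum_rank u) (enum_rank v)) => [lt_uv|lt_vu|E].
- by exists (u, v); rewrite ?inE ?uv.
- by exists (v, u); rewrite ?inE /= adj_sym ?uv.
- have /enum_rank_inj uE := val_inj E.
  by move: uv; rewrite uE adj_irrefl.
Qed.

Lemma monochromatic_constant_on c (x : {ffun G -> 'I_c}) s :
  monochromatic (colors x) s = constant_on x [set s a | a : H].
Proof.
apply/idP/constant_onP => [/forallP h _ _ /imsetP[a _ ->] /imsetP[b _ ->]|h].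
  by have /forallP/(_ b)/eqP/succn_inj/val_inj := h a.
apply/forallP => a; apply/forallP => b; rewrite /colors (h (s a) (s b))//.
  exact: imset_f.
exact: imset_f.
Qed.

(** The automorphism group acts freely on the embeddings: each copy is counted
    once per automorphism, which the normalisation cancels, and the number of
    monochromatic copies is a natural number. *)
Lemma mono_copiesE (R : realType) c (x : {ffun G -> 'I_c}) :
  mono_copies R H (colors x) =
  (mono_count (fun O : {O in copies} => copy_support (val O)) x)%:R.
Proof.
rewrite /mono_count -(big_sub copies (fun O => nat_of_bool (constant_on x (copy_support O)))).
rewrite /mono_copies.
have -> : \sum_(s : {ffun H -> G} | injectiveb s)
    ((\prod_(e in edges H) adjacency R (s e.1) (s e.2)) *
     (monochromatic (colors x) s)%:R) =
  \sum_(s in [set s | embeds s]) (constant_on x [set s a | a : H])%:R.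
  rewrite big_mkcond [RHS]big_mkcond; apply: eq_bigr => s _.
  rewrite prod_adjacency inE /embeds monochromatic_constant_on.
  by case: injectiveb => //=; case: forallP; rewrite ?mul1r ?mul0r.
rewrite (partition_big_imset copy_of)/= natr_sum mulr_sumr.
apply: eq_bigr => O /imsetP[s]; rewrite inE => sE ->.
rewrite copy_supportE.
rewrite (eq_bigr (fun=> (constant_on x [set s a | a : H])%:R)); last first.
  by move=> t /andP[_ /eqP tO]; rewrite -!copy_supportE tO.
have s_inj : injective s by apply/injectiveP; case/andP: sE.
rewrite sumr_const -[X in _ * X]mulr_natl mulrA.
have -> : #|[pred i in [set s0 | embeds s0] | copy_of i == copy_of s]| = #|graph_aut H|.
  rewrite -(card_copy_of s_inj); apply: eq_card => t; rewrite !inE.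
  apply/andP/idP => [[_ /eqP<-]|ts]; first exact: copy_of_refl.
  split; last by rewrite (copy_of_eq ts).
  by case/imsetP: ts => f fA ->; exact: embeds_relabel.
rewrite mulVf ?mul1r// pnatr_eq0 -lt0n; apply/card_gt0P.
by exists 1%g; exact: graph_aut_one.
Qed.

End copies.

Local Open Scope classical_set_scope.
Local Open Scope ring_scope.

(** * The law of a random coloring *)

Section coloring_law.
Context (R : realType) d (Omega : measurableType d) (P : probability Omega R).
Variables (G : sgraph) (c : nat) (X : G -> {RV P >-> nat}).
Hypothesis c_gt0 : (0 < c)%N.
Hypothesis X_uniform : uniform_coloring c X.

Let atom (x : {ffun G -> 'I_c}) : set Omega :=
  \bigcap_(v in [set` [set: G]%SET]) X v @^-1` [set colors x v].

Let measurable_atom x : measurable (atom x).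
Proof.
apply: fin_bigcap_measurable => // v _.
by rewrite -[_ @^-1` _]setTI; exact: measurable_funP.
Qed.

Let P_atom x : P (atom x) = (#|{: {ffun G -> 'I_c}}|%:R^-1)%:E.
Proof.
rewrite (X_uniform.1 [set: G]%SET (fun v => [set colors x v]))//.
rewrite (eq_bigr (fun=> (c%:R^-1)%:E)) => [|v _]; last first.
  by apply: X_uniform.2; rewrite /colors /= ltn_ord.
rewrite prodEFin; congr EFin.
by rewrite prodr_const cardsT card_ffun card_ord natrX exprVn.
Qed.

Let atomE x w : atom x w -> X ^~ w = colors x.
Proof. by move=> h; apply/funext => v; apply: h; rewrite /= finset.in_setT. Qed.

Let trivIset_atom : trivIset [set` enum {: {ffun G -> 'I_c}}] atom.
Proof.
move=> x y _ _ [w [/atomE xw /atomE yw]].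
apply/ffunP => v; apply/val_inj/succn_inj.
by have := congr1 (@^~ v) (etrans (esym xw) yw).
Qed.

(** The colorings with values in {1, ..., c} split a set of full measure into
    atoms of equal probability, on which h is constant. *)
Lemma ge0_integral_coloring (h : (G -> nat) -> R) :
  measurable_fun [set: Omega] (fun w => h (X ^~ w)) -> (forall z, 0 <= h z) ->
  (\int[P]_w (h (X ^~ w))%:E = (mean (h \o @colors G c))%:E)%E.
Proof.
move=> mh h0.
pose U := \big[setU/set0]_(x <- enum {: {ffun G -> 'I_c}}) atom x.
have mU : measurable U by apply: bigsetU_measurable.
have splitU (f : Omega -> \bar R) : measurable_fun [set: Omega] f ->
    (forall w, 0 <= f w)%E ->
    (\int[P]_(w in U) f w = \sum_x \int[P]_(w in atom x) f w)%E.
  move=> mf f0; rewrite /U ge0_integral_bigsetU//.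
  - by rewrite big_enum.
  - exact: enum_uniq.
  - exact: measurable_funTS.
have PU : P U = 1%E.
  rewrite -[LHS]mul1e -(integral_cst P mU) splitU//.
  rewrite (eq_bigr (fun=> (#|{: {ffun G -> 'I_c}}|%:R^-1)%:E)) => [|x _]; last first.
    by rewrite integral_cst// mul1e; exact: P_atom.
  rewrite sumEFin; congr EFin.
  rewrite sumr_const -[LHS]mulr_natr mulVf// gt_eqF//.
  exact: card_coloring_gt0.
rewrite (@ge0_negligible_integral _ _ _ _ _ (~` U))//; last first.
- by apply: etrans (probability_setC P mU) _; rewrite PU subee.
- by move=> w _; rewrite lee_fin.
- exact/measurable_EFinP.
- exact: measurableC.
rewrite setDE setCK setTI splitU//; [|exact/measurable_EFinP|by move=> w; rewrite lee_fin].
rewrite /mean mulr_suml -sumEFin; apply: eq_bigr => x _.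
rewrite (@eq_integral _ _ _ _ _ (cst (h (colors x))%:E)) => [|w]; last first.
  by rewrite inE => /atomE ->.
by rewrite integral_cst// EFinM; congr (_ * _)%E; exact: P_atom.
Qed.

Lemma expectation_T (H : sgraph) :
  'E_P[T H X]%E = (mean (@mono_copies R H G \o @colors G c))%:E.
Proof.
rewrite expectation.unlock ge0_integral_coloring//.
  exact: measurable_T_fun.
move=> z; rewrite /mono_copies mulr_ge0 ?invr_ge0// sumr_ge0// => s _.
by rewrite mulr_ge0// prodr_ge0.
Qed.

Lemma variance_T (H : sgraph) :
  'V_P[T H X]%E = (mean (fun x : {ffun G -> 'I_c} => (@mono_copies R H G (colors x)) ^+ 2) -
                   mean (@mono_copies R H G \o @colors G c) ^+ 2)%:E.
Proof.
rewrite /variance covariance.unlock expectation_T /=.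
rewrite expectation.unlock.
set m := mean _.
rewrite (ge0_integral_coloring (h := fun z => (@mono_copies R H G z - m) * (@mono_copies R H G z - m))); last 2 first.
  by apply: measurable_funM; apply: measurable_funB => //; exact: measurable_T_fun.
  by move=> z; rewrite -expr2 sqr_ge0.
congr EFin.
rewrite (_ : _ \o _ = fun x : {ffun G -> 'I_c} => (@mono_copies R H G (colors x) ^+ 2 +
   (- (2 * m)) * @mono_copies R H G (colors x)) + m ^+ 2); last first.
  by apply/funext => x /=; ring.
rewrite !meanD mean_cst// meanZ -/m; ring.
Qed.

Lemma probability_T (H : sgraph) (A : set R) : measurable A ->
  P (T H X @^-1` A) = (mean (fun x : {ffun G -> 'I_c} => \1_A (@mono_copies R H G (colors x))))%:E.
Proof.
move=> mA.
have mTA : measurable (T H X @^-1` A).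
  by rewrite -[_ @^-1` _]setTI; exact: measurable_funP.
rewrite -[_ @^-1` _]setIT -integral_indic//.
rewrite -(ge0_integral_coloring (h := fun z => \1_A (@mono_copies R H G z)))//.
apply: measurableT_comp => //; exact: measurable_T_fun.
Qed.

End coloring_law.

(** * Convergence to the Poisson weights *)

Section poisson_limit.
Variable R : realType.

Lemma cvg_mul_bounded (u v : R^nat) (M : R) : u @ \oo --> (0 : R) ->
  (forall n, `|v n| <= M) -> (fun n => u n * v n) @ \oo --> (0 : R).
Proof.
move=> u0 vM.
apply/norm_cvg0P/(@squeeze_cvgr _ _ _ _ (fun=> 0) (fun n => `|u n| * M)).
- near=> n; rewrite normr_ge0/= normrM ler_wpM2l//.
- exact: cvg_cst.
- by rewrite -(mul0r M); apply: cvgMl; apply/norm_cvg0P.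
Unshelve. all: by end_near. Qed.

(** The recursion forces q n k to be asymptotically lambda ^ k / k! times q n 0.
    The lower bound on the partial sums (a Markov inequality, in
    the application) prevents mass from escaping to infinity, so the total mass 1
    identifies the limit of q n 0 as exp (- lambda). *)
Lemma poisson_limit (lambda : R) (L : R^nat) (q : nat -> nat -> R) :
  L @ \oo --> lambda ->
  (forall n k, 0 <= q n k) ->
  (forall n K, \sum_(k < K) q n k <= 1) ->
  (forall n K, 1 - L n / K.+1%:R <= \sum_(k < K.+1) q n k) ->
  (forall k, (fun n => k.+1%:R * q n k.+1 - L n * q n k) @ \oo --> (0 : R)) ->
  forall k, q ^~ k @ \oo --> lambda ^+ k / k`!%:R * expR (- lambda).
Proof.
move=> Llam q0 q1 qL rec.
have qle1 n k : `|q n k| <= 1.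
  rewrite ger0_norm//; apply: le_trans (q1 n k.+1).
  by rewrite big_ord_recr/= lerDr sumr_ge0.
have L_lam : (fun n => L n - lambda) @ \oo --> (0 : R).
  by rewrite -(subrr lambda); apply: cvgB => //; exact: cvg_cst.
have ratio k : (fun n => q n k - lambda ^+ k / k`!%:R * q n 0%N) @ \oo --> (0 : R).
  elim: k => [|k IH].
    rewrite fact0 expr0 divr1.
    under eq_fun do rewrite mul1r subrr.
    exact: cvg_cst.
  have fk : (k`!%:R : R) != 0 by rewrite pnatr_eq0 -lt0n fact_gt0.
  have k1 : (k.+1%:R : R) != 0 by rewrite pnatr_eq0.
  rewrite (_ : (fun n => _) = fun n => k.+1%:R^-1 *
    ((k.+1%:R * q n k.+1 - L n * q n k) + (L n - lambda) * q n k +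
     lambda * (q n k - lambda ^+ k / k`!%:R * q n 0%N))); last first.
    apply/funext => n; rewrite factS natrM exprS; field.
    by rewrite fk nat1r k1.
  rewrite -(mulr0 (k.+1%:R^-1)); apply: cvgMr.
  rewrite -[X in _ --> X](_ : 0 + 0 + lambda * 0 = 0); last by rewrite mulr0 !addr0.
  apply: cvgD; last exact: cvgMr.
  by apply: cvgD; [exact: rec | exact: (@cvg_mul_bounded _ _ 1)].
pose s K : R := \sum_(k < K) lambda ^+ k / k`!%:R.
have s_cvg : s @ \oo --> expR lambda.
  rewrite (_ : s = series (exp_coeff lambda)); last first.
    apply/funext => K; rewrite /s /series/= big_mkord.
    by apply: eq_bigr.
  exact: is_cvg_series_exp_coeff.
have D_cvg K : (fun n => \sum_(k < K) q n k - s K * q n 0%N) @ \oo --> (0 : R).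
  elim: K => [|K IH].
    rewrite /s big_ord0; under eq_fun do rewrite big_ord0 mul0r subrr.
    exact: cvg_cst.
  rewrite (_ : (fun n => _) = fun n => (\sum_(k < K) q n k - s K * q n 0%N) +
     (q n K - lambda ^+ K / K`!%:R * q n 0%N)); last first.
    by apply/funext => n; rewrite /s !big_ord_recr/=; ring.
  rewrite -[X in _ --> X]addr0. apply: cvgD; [exact: IH | exact: ratio].
(* q n 0 * exp lambda and 1 are compared through the partial sums up to K. *)
have q0_cvg : (fun n => q n 0%N * expR lambda) @ \oo --> (1 : R).
  apply/cvgrPdist_le => e e0.
  have e3 : 0 < e / 3 by lra.
  have [K [sK LK]] : exists K, `|expR lambda - s K.+1| <= e / 3 /\
      (`|lambda| + 1) / K.+1%:R <= e / 3.
    have /cvgrPdist_le/(_ _ e3) : (fun K => s K.+1) @ \oo --> expR lambda.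
      by rewrite cvg_shiftS.
    have : (fun K : nat => (`|lambda| + 1) / K.+1%:R) @ \oo --> (0 : R).
      rewrite -(mulr0 (`|lambda| + 1)); apply: cvgMr; exact: cvg_harmonic.
    move=> /cvgrPdist_le/(_ _ e3) [N1 _ h1] [N2 _ h2].
    exists (maxn N1 N2); split; first by apply: h2; rewrite /= leq_maxr.
    have := h1 (maxn N1 N2); rewrite /= leq_maxl sub0r normrN => /(_ isT).
    by apply: le_trans; exact: ler_norm.
  near=> n.
  have H1 : `|\sum_(k < K.+1) q n k - s K.+1 * q n 0%N| <= e / 3.
    rewrite -normrN -[X in `|X|]sub0r; near: n.
    by move/cvgrPdist_le : (D_cvg K.+1); apply.
  have H2 : L n <= `|lambda| + 1.
    have : `|lambda - L n| <= 1 by near: n; move/cvgrPdist_le : Llam; apply.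
    have := ler_norm (L n - lambda); rewrite distrC.
    have := ler_norm lambda; lra.
  have H3 : `|1 - \sum_(k < K.+1) q n k| <= e / 3.
    rewrite ger0_norm ?subr_ge0//; apply: le_trans LK.
    apply: (@le_trans _ _ (L n / K.+1%:R)); last by rewrite ler_wpM2r.
    by rewrite lerBlDr addrC -lerBlDr.
  have H4 : `|q n 0%N * (expR lambda - s K.+1)| <= e / 3.
    rewrite normrM; apply: le_trans sK; rewrite ler_piMl//.
  have -> : 1 - q n 0%N * expR lambda = (1 - \sum_(k < K.+1) q n k) +
     (\sum_(k < K.+1) q n k - s K.+1 * q n 0%N) +
     (- (q n 0%N * (expR lambda - s K.+1))) by ring.
  apply: le_trans (ler_normD _ _) _; rewrite normrN.
  have := ler_normD (1 - \sum_(k < K.+1) q n k)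
     (\sum_(k < K.+1) q n k - s K.+1 * q n 0%N); lra.
have q0_lim : q ^~ 0%N @ \oo --> expR (- lambda).
  rewrite (_ : q ^~ 0%N = fun n => (q n 0%N * expR lambda) * expR (- lambda)); last first.
    by apply/funext => n; rewrite -mulrA -expRD subrr expR0 mulr1.
  by rewrite -[X in _ --> X]mul1r; apply: cvgMl.
move=> k.
rewrite (_ : q ^~ k = fun n => (q n k - lambda ^+ k / k`!%:R * q n 0%N) +
   lambda ^+ k / k`!%:R * q n 0%N); last by apply/funext => n; rewrite subrK.
by rewrite -[X in _ --> X]add0r; apply: cvgD => //; exact: cvgMr.
Unshelve. all: by end_near. Qed.

(** As soon as c >= 2 the factor 1 - 1 / c can be replaced by 1 / 2. *)
Lemma overlap_cvg0 (lambda : R) (c : nat -> nat) (L W ov : R^nat) :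
  (fun n => (c n)%:R^-1 : R) @ \oo --> (0 : R) ->
  L @ \oo --> lambda -> W @ \oo --> lambda ->
  (forall n, 0 <= ov n) ->
  (forall n, ov n * (1 - (c n)%:R^-1) <= W n - L n + L n / (c n)%:R) ->
  ov @ \oo --> (0 : R).
Proof.
move=> c0 Ll Wl ov0 ovW.
apply: (@squeeze_cvgr _ _ _ _ (fun=> 0) (fun n => 2 * (W n - L n + L n / (c n)%:R))).
- near=> n; rewrite ov0/=.
  have : `|0 - (c n)%:R^-1 : R| <= 2^-1.
    by near: n; move/cvgrPdist_le : c0; apply; rewrite invr_gt0.
  rewrite sub0r normrN => /(le_trans (ler_norm _)) ci.
  by have := ovW n; have := ov0 n; nra.
- exact: cvg_cst.
- rewrite -[X in _ --> X](_ : 2 * (lambda - lambda + lambda * 0) = 0); last first.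
    by rewrite mulr0 subrr addr0 mulr0.
  by apply: cvgMr; apply: cvgD; [exact: cvgB | exact: cvgM].
Unshelve. all: by end_near. Qed.

End poisson_limit.

(** * Convergence in distribution *)

Lemma initial_segment_le (R : realType) (r : R) :
  exists K, forall k : nat, (k%:R <= r) = (k < K)%N.
Proof.
have [r0|r0] := ltP r 0.
  by exists 0%N => k; rewrite ltn0; apply/negbTE; rewrite -ltNge (lt_le_trans r0).
exists (Num.truncn r).+1 => k; rewrite ltnS.
by rewrite -truncn_ge_nat.
Qed.

(** At rate 0 both sides are the mass of {0}: the convention 0 ^ 0 = 1 makes
    the series formula valid there too. *)
Lemma Pois_halfline (R : realType) (lambda r : R) K : 0 <= lambda ->
  (forall k : nat, (k%:R <= r) = (k < K)%N) ->
  Pois lambda `]-oo, r]%classic =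
  (\sum_(k < K) lambda ^+ k / k`!%:R * expR (- lambda))%:E.
Proof.
move=> lambda_ge0 rK.
have -> : Pois lambda `]-oo, r]%classic = poisson_prob lambda 0 `I_K.
  rewrite /Pois /distribution /= /pushforward; congr (poisson_prob _ _ _).
  by apply/seteqP; split => k /=; rewrite /natr in_itv /= rK.
rewrite /poisson_prob; case: ltP => [lambda_gt0|lambda_le0].
  rewrite esum_fset//; last by move=> k _; rewrite lee_fin poisson_pmf_ge0.
  rewrite -fsbig_ord -sumEFin; apply: eq_bigr => k _.
  by rewrite /poisson_pmf lambda_gt0.
have -> : lambda = 0 by apply/le_anti/andP.
rewrite oppr0 expR0 /dirac indicE.
case: K {rK} => [|K]; first by rewrite big_ord0 II0 in_set0.
rewrite big_ord_recl expr0 fact0 divr1 mulr1 big1 => [|k _]; last first.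
  by rewrite exprS !mul0r.
by rewrite addr0 mem_set.
Qed.

Theorem theorem1p1 (R : realType) (H : sgraph)
  (H_connected : connected_graph H)
  (H_card : (2 <= #|H|)%N)
  (H_neq_K2 : ~ isomorphic H (complete_graph 2))
  (G : nat -> sgraph)
  (G_infty : #|G n| @[n --> \oo] --> \oo)
  (c : nat -> nat)
  (c_gt0 : forall n, (0 < c n)%N)
  (c_infty : c n @[n --> \oo] --> \oo)
  (d : nat -> measure_display)
  (Omega : forall n, measurableType (d n))
  (P : forall n, probability (Omega n) R)
  (X : forall n, G n -> {RV (P n) >-> nat})
  (X_uniform : forall n, uniform_coloring (c n) (X n))
  (lambda : R)
  (mean_cvg : 'E_(P n)[T H (X n)]%E @[n --> \oo] --> lambda%:E)
  (var_cvg : 'V_(P n)[T H (X n)]%E @[n --> \oo] --> lambda%:E) :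
  cvg_in_distribution (fun n => T H (X n)) (Pois lambda).
Proof.
pose S n (O : {O in copies H (G n)}) := copy_support (val O).
have card_S n O : #|S n O| = #|H| := card_copy_support O.
pose L n : R := expected_count R (S n) (c n).
pose W n : R := mean (fun x : {ffun G n -> 'I_(c n)} => (mono_count (S n) x)%:R ^+ 2) - L n ^+ 2.
pose ov n : R := overlap R (S n) (c n).
pose q n k : R := count_prob R (S n) (c n) k.
have TE n : @mono_copies R H (G n) \o @colors (G n) (c n) = fun x => (mono_count (S n) x)%:R.
  by apply/funext => x; exact: mono_copiesE.
have L_cvg : L @ \oo --> lambda.
  have /fine_cvgP[_] // : (fun n => (L n)%:E) @ \oo --> lambda%:E.
  rewrite (_ : (fun n => (L n)%:E) = fun n => 'E_(P n)[T H (X n)]%E)//.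
  by apply/funext => n; rewrite (expectation_T (c_gt0 _) (X_uniform _)) TE.
have W_cvg : W @ \oo --> lambda.
  have /fine_cvgP[_] // : (fun n => (W n)%:E) @ \oo --> lambda%:E.
  rewrite (_ : (fun n => (W n)%:E) = fun n => 'V_(P n)[T H (X n)]%E)//.
  apply/funext => n; rewrite (variance_T (c_gt0 _) (X_uniform _)) TE.
  congr (_ - _)%:E; congr mean; apply/funext => x.
  by rewrite mono_copiesE.
have lambda_ge0 : 0 <= lambda.
  apply: (cvgr_to_ge L_cvg); near=> n.
  by rewrite /L (expected_countE _ H_card (card_S n))// mulr_ge0 ?mono_prob_ge0.
have c_cvg0 : (fun n => (c n)%:R^-1 : R) @ \oo --> (0 : R).
  apply/gtr0_cvgV0; first by near=> n; rewrite ltr0n.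
  exact/cvgrnyP.
have ov_cvg : ov @ \oo --> (0 : R).
  apply: (overlap_cvg0 c_cvg0 L_cvg W_cvg) => n; first exact: (overlap_ge0 R H_card (card_S n)).
  exact: (overlap_le_variance R H_card (card_S n)).
(* This b balances the two terms b^-1 / c and b of the error bound. *)
pose b n : R := Num.sqrt (c n)%:R^-1.
have b_gt0 n : 0 < b n by rewrite sqrtr_gt0 invr_gt0 ltr0n.
have b_cvg : b @ \oo --> (0 : R).
  rewrite -(@sqrtr0 R); apply: (cvg_comp _ _ c_cvg0).
  exact: sqrt_continuous.
have rec k : (fun n => k.+1%:R * q n k.+1 - L n * q n k) @ \oo --> (0 : R).
  apply/norm_cvg0P; apply: (@squeeze_cvgr _ _ _ _ (fun=> 0) (fun n =>
    L n * (c n)%:R^-1 + 2 * ov n + 2 * #|H|%:R ^+ 2 *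
      (b n * (L n + ov n) + b n * L n ^+ 2))).
  - near=> n; rewrite normr_ge0 /=.
    have := stein_recursion H_card (card_S n) (c_gt0 n) k (b_gt0 n).
    rewrite (_ : (b n)^-1 * (_ / _) = b n * (L n + ov n))//.
    rewrite -[(c n)%:R^-1](@sqr_sqrtr _ (c n)%:R^-1) ?invr_ge0// -/(b n).
    by rewrite mulrCA expr2 mulKf ?gt_eqF// mulrC.
  - exact: cvg_cst.
  - rewrite -[X in _ --> X](_ : lambda * 0 + 2 * 0 + 2 * #|H|%:R ^+ 2 *
      (0 * (lambda + 0) + 0 * lambda ^+ 2) = 0); last by ring.
    apply: cvgD; first by apply: cvgD; [exact: cvgM | exact: cvgMr].
    apply: cvgMr; apply: cvgD; first by apply: cvgM => //; exact: cvgD.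
    apply: cvgM => //; rewrite expr2; exact: cvgM.
have q_cvg := poisson_limit L_cvg (fun n k => count_prob_ge0 _ _ (c_gt0 n) k)
  (fun n K => sum_count_prob_le1 _ _ (c_gt0 n) K)
  (fun n K => sum_count_prob_ge _ _ (c_gt0 n) K) rec.
move=> r _.
have [K rK] := initial_segment_le r.
rewrite (Pois_halfline lambda_ge0 rK).
rewrite (_ : (fun n => _) = fun n => (\sum_(k < K) q n k)%:E); last first.
  apply/funext => n; rewrite /cdf /distribution /= /pushforward.
  rewrite (probability_T (c_gt0 n) (X_uniform n))// sum_count_prob; congr EFin.
  congr mean; apply/funext => x; rewrite mono_copiesE indicE.
  by rewrite -rK; congr (nat_of_bool _)%:R; apply/idP/idP; rewrite inE /= in_itv.
apply: cvg_EFin; first by near=> n.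
by apply: cvg_big => [|k _]; [exact: add_continuous | exact: q_cvg].
Unshelve. all: by end_near. Qed.
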